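(* Let $(X,\mathcal{E})$ and $(Y,\mathcal{F})$ be uniformly locally finite coarse spaces and let $\Phi\colon \mathrm{C}^*_u[X]\to \mathrm{C}^*_u[Y]$ be an isomorphism. For all $E\in\mathcal{E}$ there exists $F\in\mathcal{F}$ such that, for all $T\in \mathrm{C}^*_u[X]$, $\mathrm{supp}(T)\subset E$ implies $\mathrm{supp}(\Phi(T))\subset F$.
   Context: Coarse structures. A coarse structure on a set $X$ is a collection $\mathcal{E}$ of subsets of $X\times X$ (called entourages) which contains the diagonal $\Delta_X=\{(x,x): x\in X\}$ and is closed under taking subsets, inverses $E^{-1}=\{(x,y):(y,x)\in E\}$, finite unions, and compositions $E\circ F=\{(x,y): \exists z\ (x,z)\in E,\ (z,y)\in F\}$; $(X,\mathcal{E})$ is a coarse space. It is uniformly locally finite if $\sup_{x\in X}|\{y\in X:(x,y)\in E\}|<\infty$ for all $E\in\mathcal{E}$. For $T\in B(\ell_2(X))$ let $\mathrm{supp}(T)=\{(x,x'):\langle T\delta_x,\delta_{x'}\rangle\ne 0\}$. The algebraic uniform Roe algebra is the $*$-algebra $\mathrm{C}^*_u[X]=\{T\in B(\ell_2(X)): \mathrm{supp}(T)\in\mathcal{E}\}$. Isomorphisms between such algebras are $*$-isomorphisms. *)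

(* Defs.v *)
From HB Require Import structures.
From mathcomp Require Import all_boot all_order all_algebra.
From mathcomp Require Import finmap.
From mathcomp Require Import all_classical all_reals.
From mathcomp Require Import ereal numfun esum.
From mathcomp Require Import complex.
From mathcomp Require Import ring lra.

Set Implicit Arguments.
Unset Strict Implicit.
Unset Printing Implicit Defensive.

Import Order.TTheory GRing.Theory Num.Theory.

Local Open Scope classical_set_scope.
Local Open Scope ring_scope.

(* [(B \; A)%relation] is {(x, y) | exists z, (x, z) \in A, (z, y) \in B}.
   Closure under binary unions gives all finite ones: the empty union is
   covered by [coarse_subset]. *)
Record coarse_structure (X : Type) := CoarseStructure {
  entourage : set (set (X * X)) ;
  coarse_diagonal : entourage diagonal ;
  coarse_subset : forall A B, B `<=` A -> entourage A -> entourage B ;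
  coarse_inverse : forall A, entourage A -> entourage (A^-1)%relation ;
  coarse_union : forall A B,
    entourage A -> entourage B -> entourage (A `|` B) ;
  coarse_comp : forall A B,
    entourage A -> entourage B -> entourage (B \; A)%relation }.

Definition uniformly_locally_finite (X : Type) (E : coarse_structure X) :=
  forall A, entourage E A ->
    exists n : nat, forall x : X, ([set y | A (x, y)] #<= `I_n)%card.

Section sums.
Context {R : realType} {X : choiceType}.
Implicit Types (h k a b : X -> R) (f g : X -> R[i]).
Local Notation normc := Normc.normc.

(* [esum] is meant for nonnegative families; an absolutely summable real family
   is summed as positive part minus negative part. *)
Definition rsum h : R :=
  fine (\esum_(x in setT) ((EFin \o h)^\+)%E x) -
  fine (\esum_(x in setT) ((EFin \o h)^\-)%E x).

Definition csum f : R[i] :=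
  Complex (rsum (fun x => complex.Re (f x))) (rsum (fun x => complex.Im (f x))).

Lemma normc_sqE (z : R[i]) : normc z ^+ 2 = complex.Re z ^+ 2 + complex.Im z ^+ 2.
Proof. by case: z => a b /=; rewrite sqr_sqrtr// addr_ge0 ?sqr_ge0. Qed.

Definition nnsum a : R := fine (\esum_(x in setT) (a x)%:E).
Definition nnsummable a : Prop :=
  (forall x, 0 <= a x) /\ (\esum_(x in setT) (a x)%:E < +oo)%E.

Lemma nnsumE a : nnsummable a -> (nnsum a)%:E = (\esum_(x in setT) (a x)%:E)%E.
Proof.
move=> [a0 aoo]; rewrite /nnsum fineK// ge0_fin_numE//.
by apply: esum_ge0 => x _; rewrite lee_fin.
Qed.

Lemma nnsum_ge0 a : (forall x, 0 <= a x) -> 0 <= nnsum a.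
Proof. by move=> a0; apply: fine_ge0; apply: esum_ge0 => x _; rewrite lee_fin. Qed.

Lemma esum_le_seq a (B : R) :
  (forall s : seq X, uniq s -> \sum_(x <- s) a x <= B) ->
  (\esum_(x in setT) (a x)%:E <= B%:E)%E.
Proof.
move=> aB; apply: ge_ereal_sup => _ [F [finF _] <-].
rewrite fsbig_finite//= sumEFin lee_fin; apply: aB.
exact: fset_uniq.
Qed.

Lemma seq_le_esum a (s : seq X) : uniq s ->
  ((\sum_(x <- s) a x)%:E <= \esum_(x in setT) (a x)%:E)%E.
Proof.
move=> us; apply: esum_ge; exists [set` s].
  by split => //; exact: finite_seq.
by rewrite -fsbig_seq// sumEFin.
Qed.

Lemma nnsummable_seq a (B : R) : (forall x, 0 <= a x) ->
  (forall s : seq X, uniq s -> \sum_(x <- s) a x <= B) -> nnsummable a.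
Proof.
by move=> a0 aB; split=> //; apply: le_lt_trans (esum_le_seq aB) _; rewrite ltry.
Qed.

Lemma seq_le_nnsum a (s : seq X) : nnsummable a -> uniq s ->
  \sum_(x <- s) a x <= nnsum a.
Proof. by move=> ha us; rewrite -lee_fin nnsumE// seq_le_esum. Qed.

Lemma nnsum_le_seq a (B : R) : (forall x, 0 <= a x) ->
  (forall s : seq X, uniq s -> \sum_(x <- s) a x <= B) -> nnsum a <= B.
Proof.
move=> a0 aB; rewrite -lee_fin nnsumE; first exact: esum_le_seq.
exact: nnsummable_seq aB.
Qed.

Lemma nnsummable_le a b : (forall x, 0 <= a x <= b x) -> nnsummable b ->
  nnsummable a.
Proof.
move=> ab [b0 boo]; split; first by move=> x; case/andP: (ab x).
apply: le_lt_trans boo; apply: le_esum => x _; rewrite lee_fin.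
by case/andP: (ab x).
Qed.

Lemma le_nnsum a b : (forall x, 0 <= a x <= b x) -> nnsummable b ->
  nnsum a <= nnsum b.
Proof.
move=> ab hb; apply: nnsum_le_seq => [x|s us]; first by case/andP: (ab x).
apply: le_trans (seq_le_nnsum hb us); apply: ler_sum => x _.
by case/andP: (ab x).
Qed.

Lemma nnsummableD a b : nnsummable a -> nnsummable b ->
  nnsummable (fun x => a x + b x).
Proof.
move=> ha hb; apply: (@nnsummable_seq _ (nnsum a + nnsum b)) => [x|s us].
  by rewrite addr_ge0// ?ha.1 ?hb.1.
by rewrite big_split/= lerD// seq_le_nnsum.
Qed.

Lemma nnsumD a b : nnsummable a -> nnsummable b ->
  nnsum (fun x => a x + b x) = nnsum a + nnsum b.
Proof.
move=> ha hb; apply: EFin_inj; rewrite EFinD !nnsumE//;   last exact: nnsummableD.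
by apply: (esumD (a := EFin \o a) (b := EFin \o b)) => x _;
  rewrite lee_fin ?ha.1 ?hb.1.
Qed.

Lemma nnsummableZ a (c : R) : 0 <= c -> nnsummable a ->
  nnsummable (fun x => c * a x).
Proof.
move=> c0 ha; apply: (@nnsummable_seq _ (c * nnsum a)) => [x|s us].
  by rewrite mulr_ge0// ha.1.
by rewrite -mulr_sumr ler_wpM2l// seq_le_nnsum.
Qed.

Lemma nnsumZ a (c : R) : 0 <= c -> nnsummable a ->
  nnsum (fun x => c * a x) = c * nnsum a.
Proof.
move=> c0 ha; apply/eqP; rewrite eq_le; apply/andP; split.
  apply: nnsum_le_seq => [x|s us]; first by rewrite mulr_ge0// ha.1.
  by rewrite -mulr_sumr ler_wpM2l// seq_le_nnsum.
have [->|cn0] := eqVneq c 0.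
  by rewrite mul0r nnsum_ge0// => x; rewrite mul0r.
have cp : 0 < c by rewrite lt_def cn0.
rewrite mulrC -ler_pdivlMr//; apply: nnsum_le_seq => [|s us]; first exact: ha.1.
rewrite ler_pdivlMr// mulrC mulr_sumr.
by apply: seq_le_nnsum => //; exact: nnsummableZ.
Qed.

Definition rsummable h : Prop := nnsummable (fun x => `|h x|).

Let pos h x := Num.max (h x) 0.
Let neg h x := Num.max (- h x) 0.

Let pos_bound h x : 0 <= pos h x <= `|h x|.
Proof. by rewrite le_max lexx orbT/= ge_max ler_norm normr_ge0. Qed.
Let neg_bound h x : 0 <= neg h x <= `|h x|.
Proof. by rewrite le_max lexx orbT/= ge_max -normrN ler_norm normr_ge0. Qed.
Let summable_pos h : rsummable h -> nnsummable (pos h).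
Proof. exact: nnsummable_le (pos_bound h). Qed.
Let summable_neg h : rsummable h -> nnsummable (neg h).
Proof. exact: nnsummable_le (neg_bound h). Qed.

Lemma rsumE h : rsum h = nnsum (pos h) - nnsum (neg h).
Proof.
rewrite /rsum /nnsum; congr (fine _ - fine _); apply: eq_esum => x _.
  by rewrite funeposE/= /pos EFin_max.
by rewrite funenegE/= /neg EFin_max.
Qed.

Let pos_sub_neg h x : pos h x - neg h x = h x.
Proof. by rewrite /pos /neg; case: (leP (h x) 0); case: (leP (- h x) 0); lra. Qed.

Lemma rsum_sub h a b : nnsummable a -> nnsummable b ->
  (forall x, h x = a x - b x) -> rsum h = nnsum a - nnsum b.
Proof.
move=> ha hb hE.
have hs : rsummable h.
  apply: nnsummable_le (nnsummableD ha hb) => x; rewrite normr_ge0/= hE.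
  by rewrite (le_trans (ler_normB _ _))// !ger0_norm// ?ha.1 ?hb.1.
rewrite rsumE; apply/eqP; rewrite subr_eq addrAC eq_sym subr_eq; apply/eqP.
rewrite -!nnsumD//; try by [exact: summable_pos|exact: summable_neg].
by congr nnsum; apply/funext => x; have := pos_sub_neg h x; rewrite hE; lra.
Qed.

Lemma rsummableD h k : rsummable h -> rsummable k ->
  rsummable (fun x => h x + k x).
Proof.
move=> hh hk; apply: nnsummable_le (nnsummableD hh hk) => x.
by rewrite normr_ge0 ler_normD.
Qed.

Lemma rsumD h k : rsummable h -> rsummable k ->
  rsum (fun x => h x + k x) = rsum h + rsum k.
Proof.
move=> hh hk.
rewrite (@rsum_sub _ (fun x => pos h x + pos k x) (fun x => neg h x + neg k x)).
- rewrite !nnsumD; [|exact: summable_neg|exact: summable_neg|exact: summable_pos|exact: summable_pos].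
  by rewrite !rsumE; lra.
- by apply: nnsummableD; exact: summable_pos.
- by apply: nnsummableD; exact: summable_neg.
- by move=> x; have := pos_sub_neg h x; have := pos_sub_neg k x; lra.
Qed.

Lemma rsumN h : rsum (fun x => - h x) = - rsum h.
Proof.
rewrite !rsumE opprB; congr (nnsum _ - _).
by congr nnsum; apply/funext => x; rewrite /neg opprK.
Qed.

Lemma rsummableZ h (c : R) : rsummable h -> rsummable (fun x => c * h x).
Proof.
move=> hh; apply: nnsummable_le (nnsummableZ (normr_ge0 c) hh) => x.
by rewrite normr_ge0 normrM/=.
Qed.

Lemma rsumZ h (c : R) : rsummable h -> rsum (fun x => c * h x) = c * rsum h.
Proof.
move=> hh; wlog c0 : c / 0 <= c.
  move=> H; have [|c0] := leP 0 c; first exact: H.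
  rewrite -[c]opprK mulNr -H ?oppr_ge0 1?ltW// -rsumN.
  by congr rsum; apply/funext => x; rewrite mulNr.
rewrite (@rsum_sub _ (fun x => c * pos h x) (fun x => c * neg h x)).
- by rewrite !nnsumZ//; [rewrite rsumE mulrBr|exact: summable_neg|exact: summable_pos].
- by apply: nnsummableZ => //; exact: summable_pos.
- by apply: nnsummableZ => //; exact: summable_neg.
- by move=> x; rewrite -mulrBr pos_sub_neg.
Qed.

Lemma le_rsum h a : (forall x, `|h x| <= a x) -> nnsummable a ->
  `|rsum h| <= nnsum a.
Proof.
move=> ha sa; have hh : rsummable h.
  by apply: nnsummable_le sa => x; rewrite normr_ge0 ha.
rewrite rsumE ler_norml lerBlDr lerBrDl.
have hn := le_nnsum (neg_bound h) hh; have hp := le_nnsum (pos_bound h) hh.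
have ab : nnsum (fun x => `|h x|) <= nnsum a.
  by apply: le_nnsum => // x; rewrite normr_ge0 ha.
have p0 : 0 <= nnsum (pos h) by apply: nnsum_ge0 => x; case/andP: (pos_bound h x).
have n0 : 0 <= nnsum (neg h) by apply: nnsum_ge0 => x; case/andP: (neg_bound h x).
by apply/andP; split; lra.
Qed.

Lemma rsum_single h (y : X) : (forall x, x != y -> h x = 0) -> rsum h = h y.
Proof.
move=> hE; have H a : (forall x, 0 <= a x) -> (forall x, x != y -> a x = 0) -> nnsum a = a y.
  move=> a0 aE; rewrite /nnsum (esumID [set y])/= ?setTI; last by move=> x _; rewrite lee_fin.
  rewrite esum_set1 ?lee_fin// esum1 ?adde0// => x /= xy.
  by rewrite aE//; exact/eqP.
rewrite rsumE !H ?pos_sub_neg//.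
- by move=> x; case/andP: (neg_bound h x).
- by move=> x /hE; rewrite /neg => ->; rewrite oppr0 maxxx.
- by move=> x; case/andP: (pos_bound h x).
- by move=> x /hE; rewrite /pos => ->; rewrite maxxx.
Qed.

End sums.

Section ell2.
Context (R : realType) (X : choiceType).
Local Notation normc := Normc.normc.

Definition square_summable : {pred X -> R[i]^o} :=
  fun f => (\esum_(x in setT) (normc (f x) ^+ 2)%:E < +oo)%E.

Lemma square_summableP (f : X -> R[i]) :
  square_summable f <-> nnsummable (fun x => normc (f x) ^+ 2).
Proof. by split=> [foo|[]//]; split=> // x; exact: sqr_ge0. Qed.

Lemma normc_sqD (z w : R[i]) :
  normc (z + w) ^+ 2 <= 2 * normc z ^+ 2 + 2 * normc w ^+ 2.
Proof.
rewrite !normc_sqE; case: z w => [a b] [c d] /=.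
have := sqr_ge0 (a - c); have := sqr_ge0 (b - d).
by rewrite !expr2; nra.
Qed.

Lemma square_summable_submod : submod_closed square_summable.
Proof.
split=> [|c f g].
  rewrite /in_mem/=; apply/square_summableP.
  apply: (@nnsummable_seq _ _ _ 0) => [x|s us]; first exact: sqr_ge0.
  rewrite big1// => x _.
  by rewrite [W in normc W](_ : _ = 0 :> R[i])// Normc.normc0 expr0n.
rewrite /in_mem/= => /square_summableP hf /square_summableP hg.
apply/square_summableP.
have h1 := nnsummableZ (sqr_ge0 (normc c)) hf.
have h2 := nnsummableD (nnsummableZ (ler0n _ 2) h1) (nnsummableZ (ler0n _ 2) hg).
apply: nnsummable_le h2 => x; rewrite sqr_ge0/=.
by apply: le_trans (normc_sqD (c * f x) (g x)) _; rewrite Normc.normcM exprMn.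
Qed.
HB.instance Definition _ :=
  GRing.isSubmodClosed.Build _ _ square_summable square_summable_submod.

Record ell2 := Ell2 {
  ell2_fun :> X -> R[i]^o ;
  ell2P : ell2_fun \in square_summable }.
HB.instance Definition _ := [isSub for ell2_fun].
HB.instance Definition _ := [Choice of ell2 by <:].
HB.instance Definition _ := [SubChoice_isSubLmodule of ell2 by <:].

Implicit Types f g : ell2.

Definition inner f g : R[i] := csum (fun x => f x * conjc (g x)).

Definition ell2_norm f : R :=
  Num.sqrt (fine (\esum_(x in setT) (normc (f x) ^+ 2)%:E)).

Lemma delta_subproof (x0 : X) :
  (fun x => (x == x0)%:R : R[i]^o) \in square_summable.
Proof.
rewrite /in_mem/=; apply/square_summableP.
apply: (@nnsummable_seq _ _ _ 1) => [x|s us]; first exact: sqr_ge0.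
apply: (@le_trans _ _ (\sum_(x <- s) (x == x0)%:R)).
  apply: ler_sum => x _; case: (x == x0).
    by rewrite Normc.normc1 expr1n.
  by rewrite Normc.normc0 expr0n.
have [x0s|x0s] := boolP (x0 \in s).
  rewrite (bigD1_seq x0)//= eqxx big1 ?addr0// => x /negbTE -> //.
rewrite big_seq big1// => x xs; case: eqP => // xx0; move: x0s.
by rewrite -xx0 xs.
Qed.
Definition delta (x0 : X) : ell2 := Ell2 (delta_subproof x0).

Definition bounded_linear : {pred ell2 -> ell2} := fun T => `[< linear T /\
  exists M : R, forall f, ell2_norm (T f) <= M * ell2_norm f >].

Definition nsq f : R := nnsum (fun x => normc (f x) ^+ 2).

Lemma nsq_summable f : nnsummable (fun x => normc (f x) ^+ 2).
Proof. exact/square_summableP/(ell2P f). Qed.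

Lemma nsq_ge0 f : 0 <= nsq f.
Proof. by apply: nnsum_ge0 => x; exact: sqr_ge0. Qed.

Lemma ell2_normE f : ell2_norm f = Num.sqrt (nsq f). Proof. by []. Qed.

Lemma nsqD f g : nsq (f + g) <= 2 * nsq f + 2 * nsq g.
Proof.
have hf := nsq_summable f; have hg := nsq_summable g.
rewrite -!nnsumZ// -nnsumD; [|exact: nnsummableZ..].
apply: le_nnsum => [x|]; last by apply: nnsummableD; exact: nnsummableZ.
by rewrite sqr_ge0; exact: normc_sqD.
Qed.

Lemma nsqZ (c : R[i]) f : nsq (c *: f) = normc c ^+ 2 * nsq f.
Proof.
rewrite -nnsumZ ?sqr_ge0//; last exact: nsq_summable.
by congr nnsum; apply/funext => x; rewrite -exprMn -Normc.normcM.
Qed.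

Lemma bounded_linearP (T : ell2 -> ell2) : bounded_linear T <->
  linear T /\ exists2 K : R, 0 <= K & forall f, nsq (T f) <= K * nsq f.
Proof.
split=> [/asboolP[lT [M TM]]|[lT [K K0 TK]]].
  split=> //; exists (M ^+ 2); first exact: sqr_ge0.
  move=> f; have h0 : 0 <= ell2_norm (T f) by exact: sqrtr_ge0.
  have := TM f; rewrite -ler_sqr ?nnegrE// ?(le_trans h0)//.
  by rewrite exprMn !ell2_normE !sqr_sqrtr// nsq_ge0.
apply/asboolP; split=> //; exists (Num.sqrt K) => f.
by rewrite !ell2_normE -sqrtrM// ler_wsqrtr.
Qed.

Lemma bounded_linear_submod : submod_closed bounded_linear.
Proof.
split=> [|c S T].
  rewrite /in_mem/=; apply/bounded_linearP; split.
    move=> a u v; have E : a *: 0 + 0 = 0 :> ell2 by rewrite scaler0 addr0.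
    exact: esym E.
  exists 0 => // f; rewrite mul0r.
  have -> : (0 : ell2 -> ell2) f = (0 : R[i]) *: f by rewrite scale0r.
  by rewrite nsqZ Normc.normc0 expr0n mul0r.
rewrite /in_mem/= => /bounded_linearP[lS [K K0 SK]].
move=> /bounded_linearP[lT [L L0 TL]]; apply/bounded_linearP; split.
  move=> a u v; have E (V : lmodType R[i]) (s1 s2 t1 t2 : V) :
      c *: (a *: s1 + s2) + (a *: t1 + t2) = a *: (c *: s1 + t1) + (c *: s2 + t2).
    by rewrite !scalerDr !scalerA [c * a]mulrC addrACA.
  by have := E _ (S u) (S v) (T u) (T v); rewrite -lS -lT.
have cK0 : 0 <= normc c ^+ 2 * K := mulr_ge0 (sqr_ge0 _) K0.
exists (2 * (normc c ^+ 2 * K) + 2 * L).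
  exact: addr_ge0 (mulr_ge0 (ler0n _ 2) cK0) (mulr_ge0 (ler0n _ 2) L0).
move=> f; apply: le_trans (nsqD (c *: S f) (T f)) _.
rewrite nsqZ; have := ler_wpM2l (sqr_ge0 (normc c)) (SK f); have := TL f.
by lra.
Qed.
HB.instance Definition _ :=
  GRing.isSubmodClosed.Build _ _ bounded_linear bounded_linear_submod.

Record bounded_op := BoundedOp {
  bounded_op_fun :> ell2 -> ell2 ;
  bounded_opP : bounded_op_fun \in bounded_linear }.
HB.instance Definition _ := [isSub for bounded_op_fun].
HB.instance Definition _ := [Choice of bounded_op by <:].
HB.instance Definition _ := [SubChoice_isSubLmodule of bounded_op by <:].

Lemma op_comp_subproof (S T : bounded_op) :
  (fun f => S (T f)) \in bounded_linear.
Proof.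
rewrite /in_mem/=.
have /bounded_linearP[lS [K K0 SK]] := bounded_opP S.
have /bounded_linearP[lT [L L0 TL]] := bounded_opP T.
apply/bounded_linearP; split=> [a u v|]; first by rewrite lT lS.
exists (K * L) => [|f]; first exact: mulr_ge0.
by rewrite (le_trans (SK _))// -mulrA ler_wpM2l.
Qed.
Definition op_comp (S T : bounded_op) := BoundedOp (op_comp_subproof S T).

Lemma Re_mulJ_bound (z w : R[i]) (t : R) : 0 < t ->
  `|complex.Re (z * conjc w)| <= 2^-1 * (t * normc z ^+ 2 + t^-1 * normc w ^+ 2).
Proof.
move=> t0; rewrite !normc_sqE; case: z w => [a b] [c d] /=.
have tV : t * t^-1 = 1 by rewrite mulfV// gt_eqF.
have V0 : 0 < t^-1 by rewrite invr_gt0.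
have K (p q : R) : `|p * q| <= 2^-1 * (t * p ^+ 2 + t^-1 * q ^+ 2).
  have H (r : R) : 2 * (p * r) <= t * p ^+ 2 + t^-1 * r ^+ 2.
    have := mulr_ge0 (ltW V0) (sqr_ge0 (t * p - r)).
    suff -> : t^-1 * (t * p - r) ^+ 2 =
      (t * t^-1) * (t * p ^+ 2) - (t * t^-1) * (2 * (p * r)) + t^-1 * r ^+ 2.
      by rewrite tV !mul1r; lra.
    by ring.
  have h1 := H q; have := H (- q); rewrite sqrrN mulrN => h2.
  by rewrite ler_norml; apply/andP; split; lra.
have := K a c; have := K b d.
have := ler_normD (a * c) (b * d).
suff -> : a * c - b * - d = a * c + b * d by lra.
by rewrite mulrN opprK.
Qed.

Lemma Im_ReNi (z : R[i]) : complex.Im z = complex.Re (- (Complex 0 1) * z).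
Proof. by case: z => a b /=; rewrite oppr0 mul0r sub0r mulN1r opprK. Qed.

Lemma inner_summable_Re f g :
  rsummable (fun x => complex.Re (f x * conjc (g x))).
Proof.
have hf := nsq_summable f; have hg := nsq_summable g.
have h1 : 0 <= 1 :> R by []. have hh : 0 <= 2^-1 :> R by rewrite invr_ge0.
apply: nnsummable_le (nnsummableZ hh
  (nnsummableD (nnsummableZ h1 hf) (nnsummableZ h1 hg))) => x.
by rewrite normr_ge0/=; have := Re_mulJ_bound (f x) (g x) ltr01; rewrite invr1.
Qed.

Lemma inner_summable_Im f g :
  rsummable (fun x => complex.Im (f x * conjc (g x))).
Proof.
rewrite (_ : (fun x => _) = fun x =>
  complex.Re ((- (Complex 0 1) *: f : ell2) x * conjc (g x))).
  exact: inner_summable_Re.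
by apply/funext => x; rewrite Im_ReNi mulrA.
Qed.

Lemma innerDl f1 f2 g : inner (f1 + f2) g = inner f1 g + inner f2 g.
Proof.
rewrite /inner /csum; apply/eqP; rewrite eq_complex/=; apply/andP; split; apply/eqP.
  rewrite -rsumD; [|exact: inner_summable_Re..].
  congr rsum; apply/funext => x.
  rewrite [W in W * _](_ : _ = (f1 x : R[i]) + f2 x)// mulrDl.
  by case: (_ * _) (_ * _) => [? ?] [].
rewrite -rsumD; [|exact: inner_summable_Im..].
congr rsum; apply/funext => x.
rewrite [W in W * _](_ : _ = (f1 x : R[i]) + f2 x)// mulrDl.
by case: (_ * _) (_ * _) => [? ?] [].
Qed.

Lemma innerZl (c : R[i]) f g : inner (c *: f) g = c * inner f g.
Proof.
have hr := inner_summable_Re f g; have hi := inner_summable_Im f g.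
rewrite /inner /csum; apply/eqP; rewrite eq_complex; case: c => p q /=.
rewrite -mulNr -!rsumZ// -!rsumD.
2-5: by apply: rsummableZ.
apply/andP; split; apply/eqP; congr rsum; apply/funext => x.
  rewrite [W in W * _](_ : _ = Complex p q * (f x : R[i]))// -mulrA.
  by case: (_ * conjc _) => a b /=; rewrite mulNr.
rewrite [W in W * _](_ : _ = Complex p q * (f x : R[i]))// -mulrA.
by case: (_ * conjc _) => a b /=; rewrite addrC.
Qed.

Lemma innerC f g : inner g f = conjc (inner f g).
Proof.
rewrite /inner /csum /=; congr Complex.
  congr rsum; apply/funext => x.
  by case: (f x) (g x) => [a b] [c d] /=; ring.
rewrite -rsumN; congr rsum; apply/funext => x.
by case: (f x) (g x) => [a b] [c d] /=; ring.
Qed.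

Lemma inner_delta f x : inner f (delta x) = f x.
Proof.
rewrite /inner /csum !(@rsum_single _ _ _ x).
- rewrite /= eqxx; case: (f x) => a b.
  by congr Complex => /=; ring.
- by move=> y /negbTE /= ->; case: (f y) => a b /=; ring.
- by move=> y /negbTE /= ->; case: (f y) => a b /=; ring.
Qed.

Lemma inner_nsq f : complex.Re (inner f f) = nsq f.
Proof.
rewrite /= (@rsum_sub _ _ _ (fun x => normc (f x) ^+ 2) (fun x => 0 * normc (f x) ^+ 2)).
- by rewrite nnsumZ//; [rewrite mul0r subr0|exact: nsq_summable].
- exact: nsq_summable.
- by apply: nnsummableZ => //; exact: nsq_summable.
- by move=> x; rewrite normc_sqE; case: (f x) => a b /=; ring.
Qed.

Lemma Re_inner_bound f g (t : R) : 0 < t ->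
  `|complex.Re (inner f g)| <= 2^-1 * (t * nsq f + t^-1 * nsq g).
Proof.
move=> t0; have hf := nsq_summable f; have hg := nsq_summable g.
have t0' := ltW t0; have V0 : 0 <= t^-1 by rewrite invr_ge0.
have hh : 0 <= 2^-1 :> R by rewrite invr_ge0.
rewrite -!nnsumZ// -nnsumD; [|exact: nnsummableZ..].
rewrite -nnsumZ//; last by apply: nnsummableD; exact: nnsummableZ.
apply: le_rsum => [x|]; first exact: Re_mulJ_bound.
by apply: nnsummableZ => //; apply: nnsummableD; exact: nnsummableZ.
Qed.

Arguments inner : simpl never.

HB.instance Definition _ (T : bounded_op) :=
  GRing.isLinear.Build R[i] ell2 ell2 *:%R T
    (proj1 (proj1 (bounded_linearP T) (bounded_opP T))).

Lemma nsq_bounded (T : bounded_op) :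
  exists2 K : R, 0 <= K & forall f, nsq (T f) <= K * nsq f.
Proof. exact: proj2 (proj1 (bounded_linearP T) (bounded_opP T)). Qed.

Lemma inner0l g : inner 0 g = 0.
Proof. by have := innerZl 0 0 g; rewrite scale0r mul0r. Qed.

Lemma conjcD (z w : R[i]) : conjc (z + w) = conjc z + conjc w.
Proof. exact: rmorphD. Qed.

Lemma conjcM (z w : R[i]) : conjc (z * w) = conjc z * conjc w.
Proof. exact: rmorphM. Qed.

Lemma innerDr f g1 g2 : inner f (g1 + g2) = inner f g1 + inner f g2.
Proof. by rewrite innerC innerDl conjcD -!innerC. Qed.

Lemma innerZr (c : R[i]) f g : inner f (c *: g) = conjc c * inner f g.
Proof. by rewrite innerC innerZl conjcM -innerC. Qed.

Lemma inner_suml (s : seq X) (c : X -> R[i]) (e : X -> ell2) g :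
  inner (\sum_(x <- s) c x *: e x) g = \sum_(x <- s) c x * inner (e x) g.
Proof.
elim: s => [|x s IH]; first by rewrite !big_nil inner0l.
by rewrite !big_cons innerDl innerZl IH.
Qed.

Definition dsum (c : X -> R[i]) (s : seq X) : ell2 :=
  \sum_(x <- s) c x *: delta x.

Lemma inner_dsum c s g : inner (dsum c s) g = \sum_(x <- s) c x * conjc (g x).
Proof.
rewrite inner_suml; apply: eq_bigr => x _.
by rewrite innerC inner_delta.
Qed.

Lemma delta_eq (x y : X) : delta x y = (y == x)%:R :> R[i]. Proof. by []. Qed.

Lemma dsumE c s y : uniq s -> y \in s -> dsum c s y = c y :> R[i].
Proof.
move=> us ys; rewrite -inner_delta inner_suml (bigD1_seq y)//=.
rewrite inner_delta delta_eq eqxx mulr1 big1 ?addr0// => x xy.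
by rewrite inner_delta delta_eq eq_sym (negbTE xy) mulr0.
Qed.

Lemma Re_mulJ (z : R[i]) : complex.Re (z * conjc z) = normc z ^+ 2.
Proof. by rewrite normc_sqE; case: z => a b /=; ring. Qed.

Lemma Re_sum (s : seq X) (a : X -> R[i]) :
  complex.Re (\sum_(x <- s) a x) = \sum_(x <- s) complex.Re (a x).
Proof.
elim: s => [|x s IH]; first by rewrite !big_nil.
by rewrite !big_cons -IH; case: (a x) => ? ?; case: (\sum_(_ <- _) _).
Qed.

Lemma nsq_dsum c s : uniq s -> nsq (dsum c s) = \sum_(x <- s) normc (c x) ^+ 2.
Proof.
move=> us; rewrite -inner_nsq inner_dsum Re_sum big_seq [RHS]big_seq.
by apply: eq_bigr => x xs; rewrite dsumE// Re_mulJ.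
Qed.

Lemma ReD (z w : R[i]) : complex.Re (z + w) = complex.Re z + complex.Re w.
Proof. by case: z w => [? ?] []. Qed.

Lemma ReN (z : R[i]) : complex.Re (- z) = - complex.Re z.
Proof. by case: z. Qed.

Lemma ReJ (z : R[i]) : complex.Re (conjc z) = complex.Re z.
Proof. by case: z. Qed.

Lemma nsq_tail f s : uniq s ->
  nsq (f - dsum f s) = nsq f - \sum_(x <- s) normc (f x) ^+ 2.
Proof.
move=> us; have h : complex.Re (inner (dsum f s) f) = \sum_(x <- s) normc (f x) ^+ 2.
  by rewrite inner_dsum Re_sum; apply: eq_bigr => x _; rewrite Re_mulJ.
have h2 : complex.Re (inner f (dsum f s)) = \sum_(x <- s) normc (f x) ^+ 2.
  by rewrite innerC ReJ.
have := nsq_dsum f us; rewrite -!inner_nsq => h3.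
rewrite -scaleN1r innerDl !innerDr !innerZl !innerZr (rmorphN1 conjc) !mulN1r.
by rewrite opprK !ReD !ReN h h2 h3; lra.
Qed.

Lemma dsum_dense f (e : R) : 0 < e -> exists2 s, uniq s & nsq (f - dsum f s) < e.
Proof.
move=> e0; apply: contrapT => H.
suff : nsq f <= nsq f - e by lra.
apply: nnsum_le_seq => [x|s us]; first exact: sqr_ge0.
have [h|] := leP e (nsq (f - dsum f s)); first by move: h; rewrite nsq_tail//; lra.
by move=> h; exfalso; apply: H; exists s.
Qed.

Lemma adjoint_nsq_bound (T : bounded_op) : exists2 K : R, 0 <= K & forall g s,
  uniq s -> \sum_(x <- s) normc (inner g (T (delta x))) ^+ 2 <= K * nsq g.
Proof.
have [K K0 TK] := nsq_bounded T.
have L0 : 0 < K + 1 by rewrite ltr_wpDl.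
exists (K + 1); first exact: ltW.
move=> g s us; set h := fun x => inner g (T (delta x)).
have E : complex.Re (inner (T (dsum h s)) g) = \sum_(x <- s) normc (h x) ^+ 2.
  have -> : T (dsum h s) = \sum_(x <- s) h x *: T (delta x).
    by rewrite /dsum linear_sum; apply: eq_bigr => x _; rewrite linearZ.
  rewrite inner_suml Re_sum; apply: eq_bigr => x _.
  by rewrite innerC -/(h x) Re_mulJ.
have V0 : 0 < (K + 1)^-1 by rewrite invr_gt0.
have := Re_inner_bound (T (dsum h s)) g V0; rewrite E invrK => B.
have := TK (dsum h s); rewrite nsq_dsum// => B2.
have S0 : 0 <= \sum_(x <- s) normc (h x) ^+ 2 by apply: sumr_ge0 => x _; exact: sqr_ge0.
move: B B2 S0; set S := \sum_(x <- s) _ => B B2 S0.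
have B3 : (K + 1)^-1 * nsq (T (dsum h s)) <= S.
  by rewrite mulrC ler_pdivrMr//; lra.
have := ler_norm S; lra.
Qed.

Lemma adjoint_val_subproof (T : bounded_op) (g : ell2) :
  (fun x => inner g (T (delta x)) : R[i]^o) \in square_summable.
Proof.
have [K K0 TK] := adjoint_nsq_bound T.
rewrite /in_mem/=; apply/square_summableP.
apply: (@nnsummable_seq _ _ _ (K * nsq g)) => [x|s us]; first exact: sqr_ge0.
exact: TK.
Qed.

(* (T^* g)(x) = <g, T delta_x>; see [adjointP]. *)
Let adjoint_val (T : bounded_op) (g : ell2) := Ell2 (adjoint_val_subproof T g).

Lemma adjoint_bounded (T : bounded_op) : adjoint_val T \in bounded_linear.
Proof.
rewrite /in_mem/=; apply/bounded_linearP; split=> [a u v|].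
  apply: val_inj; apply/funext => x.
  by rewrite /= innerDl innerZl.
have [K K0 TK] := adjoint_nsq_bound T; exists K => // g.
by apply: nnsum_le_seq => [x|s us]; [exact: sqr_ge0|exact: TK].
Qed.

Definition adjoint (T : bounded_op) := BoundedOp (adjoint_bounded T).

Lemma adjointP (T : bounded_op) f g : inner (T f) g = inner f (adjoint T g).
Proof.
pose D f := inner (T f) g - inner f (adjoint T g).
have Ddelta x : D (delta x) = 0.
  suff -> : D (delta x) = inner (T (delta x)) g - inner (T (delta x)) g.
    exact: subrr.
  by congr (_ - _); rewrite [LHS]innerC inner_delta [RHS]innerC.
have DD f1 f2 : D (f1 + f2) = D f1 + D f2.
  by rewrite /D linearD/= !innerDl; ring.
have DZ c f1 : D (c *: f1) = c * D f1.
  by rewrite /D linearZ/= !innerZl mulrBr.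
have Dsum c s : D (dsum c s) = 0.
  rewrite /dsum; elim: s => [|x s IH].
    by rewrite big_nil -[0](scale0r (0 : ell2)) DZ mul0r.
  by rewrite big_cons DD DZ Ddelta mulr0 IH addr0.
have [K K0 TK] := nsq_bounded T.
pose c := nsq g + nsq (adjoint T g) + 1.
have c0 : 0 < c by rewrite ltr_wpDl// addr_ge0// nsq_ge0.
have ReD0 f1 : complex.Re (D f1) = 0.
  apply/eqP; rewrite -normr_le0; case: leP => // d0.
  set d := `|_| in d0.
  have t0 : 0 < c / d by rewrite divr_gt0.
  have e0 : 0 < d / ((c / d) * (K + 1)) by rewrite divr_gt0// mulr_gt0// ltr_wpDl.
  have [s us se] := dsum_dense f1 e0.
  have dE : d = `|complex.Re (D (f1 - dsum f1 s))|.
    by rewrite DD -scaleN1r DZ Dsum mulr0 addr0.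
  move: se; set u := f1 - _ in dE * => se.
  have B1 := Re_inner_bound (T u) g t0.
  have B2 := Re_inner_bound u (adjoint T g) t0.
  have : d <= `|complex.Re (inner (T u) g)| + `|complex.Re (inner u (adjoint T g))|.
    by rewrite dE /D ReD ReN; exact: ler_normB.
  have TKu := ler_wpM2l (ltW t0) (TK u).
  have : (c / d)^-1 * (nsq g + nsq (adjoint T g)) <= d.
    by rewrite invf_div mulrAC ler_pdivrMr// ler_wpM2l ?(ltW d0)// /c lerDl.
  move: se; rewrite ltr_pdivlMr; last by rewrite mulr_gt0// ltr_wpDl.
  by lra.
have ImD0 : complex.Im (D f) = 0 by rewrite Im_ReNi -DZ ReD0.
apply/eqP; rewrite -subr_eq0 -/(D f); apply/eqP.
by have := ReD0 f; move: ImD0; case: (D f) => a b /= -> ->.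
Qed.

Lemma op_id_subproof : (fun f => f) \in bounded_linear.
Proof.
rewrite /in_mem/=; apply/bounded_linearP; split=> //.
by exists 1 => // f; rewrite mul1r.
Qed.
Definition op_id := BoundedOp op_id_subproof.

Let op_compA : associative op_comp.
Proof. by move=> S T U; exact: val_inj. Qed.
Let op_comp1o : left_id op_id op_comp.
Proof. by move=> S; exact: val_inj. Qed.
Let op_compo1 : right_id op_id op_comp.
Proof. by move=> S; exact: val_inj. Qed.
Let op_compDl : left_distributive op_comp +%R.
Proof. by move=> S T U; exact: val_inj. Qed.
Let op_compDr : right_distributive op_comp +%R.
Proof.
by move=> S T U; apply: val_inj; apply/funext => f; exact: (linearD S).
Qed.
HB.instance Definition _ := GRing.Zmodule_isPzRing.Build bounded_op
  op_compA op_comp1o op_compo1 op_compDl op_compDr.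

Definition supp (T : bounded_op) : set (X * X) :=
  [set p | inner (T (delta p.1)) (delta p.2) != 0].

Lemma supp_lin (a : R[i]) (S T : bounded_op) :
  supp (a *: S + T) `<=` supp S `|` supp T.
Proof.
move=> [x y] /eqP h; apply: contrapT => /not_orP[].
move=> /negP; rewrite negbK => /eqP h1 /negP; rewrite negbK => /eqP h2; apply: h.
have E : inner (a *: S (delta x) + T (delta x)) (delta y) = 0.
  by rewrite innerDl innerZl h1 h2 mulr0 addr0.
exact: E.
Qed.

Lemma supp0 : supp 0 = set0.
Proof.
apply/seteqP; split=> // -[x y] /eqP; apply; exact: inner0l.
Qed.

Lemma supp1 : supp 1 `<=` diagonal.
Proof.
move=> [x y] h; have {h} : inner (delta x) (delta y) != 0 := h.
rewrite inner_delta delta_eq; have [->//|_] := eqVneq y x.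
by move=> /eqP.
Qed.

Lemma inner_neq0 f g : inner f g != 0 -> exists2 x, f x != 0 & g x != 0.
Proof.
move=> h; apply: contrapT => H; move/eqP: h; apply.
have fg x : f x * conjc (g x) = 0 :> R[i].
  have [->|fx] := eqVneq (f x) 0; first by rewrite mul0r.
  have [->|gx] := eqVneq (g x) 0; first by rewrite conjc0 mulr0.
  by exfalso; apply: H; exists x.
rewrite -(inner0l g) /inner; congr csum; apply/funext => x.
by rewrite fg [W in W * _](_ : _ = 0 :> R[i])// mul0r.
Qed.

Lemma supp_mul (S T : bounded_op) : supp (S * T) `<=` (supp S \; supp T)%relation.
Proof.
move=> [x y] h; have {h} : inner (S (T (delta x))) (delta y) != 0 := h.
rewrite adjointP => /inner_neq0[z Tz Sz]; exists z.
  by rewrite /supp/= inner_delta.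
move: Sz; rewrite -inner_delta innerC -adjointP => Sz.
by rewrite /supp/=; apply: contraNN Sz => /eqP ->; rewrite conjc0.
Qed.

Lemma supp_adjoint (T : bounded_op) : supp (adjoint T) = (supp T)^-1%relation.
Proof.
have E x y : inner (adjoint T (delta x)) (delta y) =
    conjc (inner (T (delta y)) (delta x)).
  by rewrite (adjointP T (delta y)); exact: innerC.
apply/seteqP; split=> -[x y] /eqP h; apply/eqP => h'; apply: h.
  exact: etrans (E x y) (etrans (congr1 conjc h') (conjc0 _)).
by move: (E x y); rewrite [LHS]h' => /esym/eqP; rewrite conjc_eq0 => /eqP.
Qed.

End ell2.

Section roe.
Context (R : realType) (X : choiceType) (E : coarse_structure X).

Definition roe_pred : {pred bounded_op R X} := fun T => `[< entourage E (supp T) >].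

Lemma roe_submod : submod_closed roe_pred.
Proof.
split=> [|a S T].
  apply/asboolP; rewrite supp0.
  by apply: coarse_subset (coarse_diagonal E); exact: sub0set.
move=> /asboolP ES /asboolP ET; apply/asboolP.
by apply: coarse_subset (coarse_union ES ET); exact: supp_lin.
Qed.
HB.instance Definition _ :=
  GRing.isSubmodClosed.Build _ _ roe_pred roe_submod.

Lemma roe_subring : subring_closed roe_pred.
Proof.
split=> [|S T|S T].
- by apply/asboolP; apply: coarse_subset (coarse_diagonal E); exact: supp1.
- exact: rpredB.
move=> /asboolP ES /asboolP ET; apply/asboolP.
by apply: coarse_subset (coarse_comp ET ES); exact: supp_mul.
Qed.

Record roe := Roe {
  roe_val :> bounded_op R X ;
  roeP : roe_val \in roe_pred }.
HB.instance Definition _ := [isSub for roe_val].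
HB.instance Definition _ := [Choice of roe by <:].
HB.instance Definition _ := [SubChoice_isSubLmodule of roe by <:].
HB.instance Definition _ :=
  GRing.SubZmodule_isSubPzRing.Build (bounded_op R X) roe_pred roe roe_subring.

Lemma roe_adjoint_subproof (T : roe) : adjoint T \in roe_pred.
Proof.
apply/asboolP; rewrite supp_adjoint; apply: coarse_inverse.
exact/asboolP/(roeP T).
Qed.
Definition roe_adjoint (T : roe) : roe := Roe (roe_adjoint_subproof T).

End roe.

Definition star_isomorphism (R : realType) (X Y : choiceType)
    (E : coarse_structure X) (F : coarse_structure Y)
    (Phi : roe R E -> roe R F) : Prop :=
  [/\ linear Phi,
      {morph Phi : S T / S * T},
      {morph Phi : T / roe_adjoint T}
    & bijective Phi].

(* Main.v *)
(* Each [Phi e_x] is a minimal projection, so by uniform local finiteness it is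
   a finite matrix over [Y]; the same argument for the inverse of [Phi] makes
   each [delta_y] a finite sum of vectors [Phi e_x delta_y].  Hence, for [T]
   supported in [A], every entry of [Phi T] is a finite linear functional of the
   entries of [T], and each entry of [T] occurs in only finitely many of these
   functionals.  Local finiteness lets one choose a single bounded [T0]
   supported in [A] on which no nonzero functional vanishes; the support of
   [Phi T0] is then the required entourage. *)

Require Import Defs.
From HB Require Import structures.
From mathcomp Require Import all_boot all_order all_algebra.
From mathcomp Require Import finmap.
From mathcomp Require Import all_classical all_reals.
From mathcomp Require Import complex.
From mathcomp Require Import wochoice.

Set Implicit Arguments.
Unset Strict Implicit.
Unset Printing Implicit Defensive.

Import Order.TTheory GRing.Theory Num.Theory.

Local Open Scope classical_set_scope.

(** * A bounded vector on which no nonzero functional of a family vanishes *)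

Section nonvanishing.
Local Open Scope ring_scope.

(** Supplies the order for a recursion over coordinates: the strict part of a well-order on [T]. *)
Lemma ex_well_founded_total (T : eqType) : exists lt : rel T,
  [/\ well_founded lt, transitive lt & forall x y, x != y -> lt x y || lt y x].
Proof.
have [R woR] := well_ordering_principle T.
have woT : wo_chain R predT by move=> C _; exact: woR.
have Rtot x y : R x y || R y x by exact: (wo_chainW woT).
have Ranti x y : R x y -> R y x -> x = y.
  by move=> xy yx; apply: (wo_chain_antisymmetric woT); rewrite ?xy.
have ex_min (A : {pred T}) x : x \in A -> exists2 z, z \in A & forall y, y \in A -> R z y.
  by move=> xA; have [|z [[zA zmin] _]] := woR A; [exists x|exists z].
exists (fun x y => ~~ R y x); split.
- move=> x; apply: contrapT => nx.
  have [z /asboolP nz zmin] :=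
    ex_min [pred x | `[< ~ Acc (fun x y => ~~ R y x) x >]] x (asboolT nx).
  apply: nz; constructor => y; apply: contraNP => ny.
  exact: (zmin y (asboolT ny)).
(* Transitivity comes from the least of [x], [y], [z]: whichever it is, [R z x] becomes
   contradictory. *)
- move=> y x z Ryx Rzy; apply/negP => Rzx.
  have [u us umin] := ex_min [pred u | u \in [:: x; y; z]] x (mem_head _ _).
  have [Rux Ruy] : R u x /\ R u y.
    by split; apply: umin; rewrite !inE eqxx ?orbT.
  move: us; rewrite !inE => /or3P[]/eqP uE; rewrite uE in Rux Ruy.
  + have Ryz : R y z by have := Rtot y z; rewrite (negbTE Rzy) orbF.
    have Rxz : R x z by rewrite -uE; apply: umin; rewrite !inE eqxx ?orbT.
    by move: Rzy; rewrite -(Ranti _ _ Rxz Rzx) Ruy.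
  + by move: Ryx; rewrite Rux.
  + by move: Rzy; rewrite Ruy.
move=> x y; apply: contraNT; rewrite negb_or !negbK => /andP[Ryx Rxy].
by apply/eqP; exact: Ranti.
Qed.

Lemma ex_max_seq (T : eqType) (lt : rel T) (P : {pred T}) (s : seq T) :
  transitive lt -> (forall x y, x != y -> lt x y || lt y x) ->
  (exists2 x, x \in s & P x) ->
  exists x, [/\ x \in s, P x & forall y, y \in s -> P y -> y != x -> lt y x].
Proof.
move=> tr tot; elim: s => [[]//|a s IH] [x xs Px].
have [/hasP/IH[z [zs Pz zmax]]|/hasPn nP] := boolP (has P s); last first.
  move: xs; rewrite inE => /predU1P[xa|/nP]; last by rewrite Px.
  exists a; split; [exact: mem_head|by rewrite -xa|].
  by move=> y; rewrite inE => /predU1P[->|/nP/negbTE ->//]; rewrite eqxx.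
have [/andP[Pa lza]|nPa] := boolP (P a && lt z a).
  exists a; split=> [|//|y]; first exact: mem_head.
  rewrite inE => /predU1P[->|ys]; first by rewrite eqxx.
  move=> Py _; have [->//|yz] := eqVneq y z.
  exact: tr (zmax _ ys Py yz) lza.
exists z; split=> [|//|y]; first by rewrite inE zs orbT.
rewrite inE => /predU1P[->|]; last exact: zmax.
by move: nPa => /[swap] -> /= nza /tot; rewrite (negbTE nza) orbF.
Qed.

(** Reciprocals of positive integers are pairwise distinct and of modulus at most 1: a bounded
    supply of values that no finite list exhausts. *)
Lemma ex_inv_natS_notin (K : numFieldType) (l : seq K) :
  exists n : nat, n.+1%:R^-1 \notin l.
Proof.
apply: contrapT => H.
have sub : {subset [seq (n.+1%:R^-1 : K) | n <- iota 0 (size l).+1] <= l}.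
  move=> _ /mapP[n _ ->]; apply: contraPT isT => nl; exfalso.
  by apply: H; exists n.
have := uniq_leq_size _ sub; rewrite size_map size_iota ltnn => /(_ _)/notF; apply.
rewrite map_inj_uniq ?iota_uniq// => m n /invr_inj/eqP.
by rewrite eqr_nat eqSS => /eqP.
Qed.

(* Choosing the coordinates of [t] along a well-order, a functional is affine in
   [t p] once [p] is the last index of its support, so each [p] only has to
   avoid finitely many values. *)
Lemma ex_nonvanishing (K : numFieldType) (I P : choiceType) (s : I -> seq P)
    (c : I -> P -> K) :
  (forall i, uniq (s i)) ->
  (forall p, finite_set [set i | p \in s i /\ c i p != 0]) ->
  exists2 t : P -> K, (forall p, `|t p| <= 1) &
    forall i, (exists2 p, p \in s i & c i p != 0) ->
      \sum_(p <- s i) c i p * t p != 0.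
Proof.
move=> us fc; have [lt [wf tr tot]] := ex_well_founded_total P.
(* Values at [p] that kill some functional with nonzero coefficient there, if its earlier terms are
   given by [u] and it has no later ones. *)
pose bad p (u : P -> K) : seq K :=
  [seq - (\sum_(q <- s i | lt q p) c i q * u q) / c i p
     | i <- fset_set [set i | p \in s i /\ c i p != 0]].
pose pick l : K := (sval (cid (@ex_inv_natS_notin K l))).+1%:R^-1.
have pickP l : pick l \notin l by rewrite /pick; case: cid.
(* The default 0 is never read: [bad p] evaluates its argument only below [p]. *)
pose ext p (u : forall q, lt q p -> K) q : K :=
  if @idP (lt q p) is ReflectT h then u q h else 0.
pose t := Fix wf (fun=> K) (fun p u => pick (bad p (ext p u))).
have tE p : t p = pick (bad p t).
  rewrite /t Fix_eq; last first.
    move=> x f g fg; congr (pick (bad x (ext x _))).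
    by apply: functional_extensionality_dep => q; apply: funext.
  congr pick; apply: eq_map => i; congr (- _ / _).
  by apply: eq_bigr => q qp; rewrite /ext; case: {-}_ / idP => // /(_ qp).
exists t => [p|i ex].
  rewrite tE /pick; set n := sval _.
  by rewrite ger0_norm ?invr_ge0// invf_le1// ler1n.
have [p [ps cp pmax]] := ex_max_seq (P := fun p => c i p != 0) tr tot ex.
have ltpp : lt p p = false.
  by apply/negP; move: p {ps cp pmax}; apply: (well_founded_ind wf) => p IH /[dup]/IH.
(* Terms after [p] have coefficient 0 by maximality; if the rest summed to 0, then [t p] would lie
   in [bad p t]. *)
rewrite (bigD1_seq p)//= (bigID (fun q => lt q p))/= [X in _ + (_ + X)]big1_seq.
  rewrite addr0; apply: contraNN (pickP (bad p t)) => /eqP H.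
  rewrite -tE; apply/mapP; exists i.
    by rewrite in_fset_set// inE.
  apply: (mulfI cp); rewrite mulrCA mulfV// mulr1.
  rewrite (eq_bigl (fun q => (q != p) && lt q p)); last first.
    by move=> q; have [->|] := eqVneq q p; rewrite ?ltpp.
  by apply/eqP; rewrite -addr_eq0 H.
move=> q /andP[/andP[qp nqp] qs].
have [->|cq] := eqVneq (c i q) 0; first by rewrite mul0r.
by rewrite pmax in nqp.
Qed.
End nonvanishing.

(** * Bounded operators from kernels with uniformly finite rows and columns *)

Section kernel_operator.
Context {R : realType} {X : choiceType}.
Local Open Scope ring_scope.
Local Notation normc := Normc.normc.

Lemma uniformly_locally_finite_seq (E : coarse_structure X) A :
  uniformly_locally_finite E -> entourage E A ->
  (forall x, finite_set [set y | A (x, y)]) /\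
  exists n, forall x (s : seq X), uniq s -> {in s, forall y, A (x, y)} -> (size s <= n)%N.
Proof.
move=> hE /hE[n An].
have fA x : finite_set [set y | A (x, y)] := card_le_finite (An x) (finite_II n).
split=> //; exists n => x s us sA.
apply: leq_trans (geq_card_fset_set (An x)); rewrite -(undup_id us) -card_fseq.
by apply: fsubset_leq_card; apply/fsubsetP => y; rewrite !inE in_fset_set// inE => /sA.
Qed.

(** Iterating [normc_sqD] gives a crude factor that depends only on the number of terms, hence is
    uniform over rows of bounded length. *)
Lemma normc_sq_sum (T : eqType) (r : seq T) (a : T -> R[i]) :
  normc (\sum_(x <- r) a x) ^+ 2 <= 2 ^+ size r * \sum_(x <- r) normc (a x) ^+ 2.
Proof.
elim: r => [|x r IH]; first by rewrite !big_nil Normc.normc0 expr0n mulr0.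
rewrite !big_cons /=; apply: le_trans (normc_sqD _ _) _.
rewrite [2 ^+ _.+1]exprS -mulrA !mulrDr.
apply: lerD; last by rewrite ler_wpM2l.
by rewrite ler_wpM2l// ler_peMl ?sqr_ge0// exprn_ege1// ler1n.
Qed.

Context (r : X -> seq X) (n m : nat).
Hypothesis r_uniq : forall y, uniq (r y).
Hypothesis r_size : forall y, (size (r y) <= n)%N.
Hypothesis r_mult : forall x (s : seq X), uniq s -> {in s, forall y, x \in r y} ->
  (size s <= m)%N.

(** Double counting: each [x] lies in at most [m] of the lists [r y], so its term is counted at most
    [m] times. *)
Lemma sum_rows_le (f : ell2 R X) (s : seq X) : uniq s ->
  \sum_(y <- s) \sum_(x <- r y) normc (f x) ^+ 2 <= m%:R * nsq f.
Proof.
(* [U] gives all inner sums one common range, so that the two sums can be exchanged. *)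
move=> us; pose U := undup (flatten [seq r y | y <- s]).
have rU y : y \in s ->
    \sum_(x <- r y) normc (f x) ^+ 2 = \sum_(x <- U | x \in r y) normc (f x) ^+ 2.
  move=> ys; rewrite -[RHS]big_filter; apply: perm_big; apply: uniq_perm => //.
    by rewrite filter_uniq// undup_uniq.
  move=> x; rewrite mem_filter mem_undup; case: (boolP (x \in r y)) => //= xr.
  by apply/esym/flattenP; exists (r y) => //; apply/mapP; exists y.
rewrite big_seq (eq_bigr _ rU) -big_seq.
under eq_bigr do rewrite big_mkcond/=.
rewrite exchange_big/=.
have bound x : \sum_(y <- s) (if x \in r y then normc (f x) ^+ 2 else 0) <=
    m%:R * normc (f x) ^+ 2.
  rewrite -big_mkcond/= big_const_seq iter_addr_0 -[leLHS]mulr_natl ler_wpM2r ?sqr_ge0//.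
  rewrite ler_nat -size_filter; apply: (@r_mult x); first exact: filter_uniq.
  by move=> y; rewrite mem_filter => /andP[].
apply: le_trans (ler_sum _ (fun x _ => bound x)) _.
rewrite -mulr_sumr ler_wpM2l// seq_le_nnsum ?undup_uniq//; exact: nsq_summable.
Qed.

Context (t : X * X -> R[i]).
Hypothesis t_le1 : forall p, normc (t p) <= 1.

Let kernel_fun (f : ell2 R X) (y : X) : R[i]^o := \sum_(x <- r y) t (x, y) * f x.

Lemma kernel_fun_sum_le f (s : seq X) : uniq s ->
  \sum_(y <- s) normc (kernel_fun f y) ^+ 2 <= 2 ^+ n * m%:R * nsq f.
Proof.
move=> us; rewrite -mulrA.
apply: le_trans (ler_wpM2l _ (sum_rows_le f us)); last exact: exprn_ge0.
rewrite mulr_sumr; apply: ler_sum => y _; apply: le_trans (normc_sq_sum _ _) _.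
apply: ler_pM; [exact: exprn_ge0| |by rewrite ler_eXn2l ?ltr1n| ].
  by apply: sumr_ge0 => x _; exact: sqr_ge0.
apply: ler_sum => x _; rewrite Normc.normcM exprMn ler_piMl ?sqr_ge0//.
by rewrite exprn_ile1//; case: (t _) => ? ?; exact: sqrtr_ge0.
Qed.

Lemma kernel_fun_square_summable f : kernel_fun f \in @square_summable R X.
Proof.
rewrite /in_mem/=; apply/square_summableP.
apply: (@nnsummable_seq _ _ _ (2 ^+ n * m%:R * nsq f)) => [x|s us].
  exact: sqr_ge0.
exact: kernel_fun_sum_le.
Qed.

Let kernel_map f := Ell2 (kernel_fun_square_summable f).

Lemma kernel_map_bounded : kernel_map \in @bounded_linear R X.
Proof.
rewrite /in_mem/=; apply/bounded_linearP; split=> [a u v|].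
  apply: val_inj; apply/funext => y; rewrite /= /kernel_fun.
  rewrite [RHS](_ : _ = a * (\sum_(x <- r y) t (x, y) * (u x : R[i])) +
    \sum_(x <- r y) t (x, y) * (v x : R[i]))//.
  rewrite mulr_sumr -big_split/=; apply: eq_bigr => x _.
  by rewrite mulrCA -mulrDr.
exists (2 ^+ n * m%:R) => [|f]; first by rewrite mulr_ge0 ?exprn_ge0.
by apply: nnsum_le_seq => [y|s us]; [exact: sqr_ge0|exact: kernel_fun_sum_le].
Qed.

Definition kernel_op := BoundedOp kernel_map_bounded.

Lemma kernel_op_delta x y : kernel_op (delta R x) y = (x \in r y)%:R * t (x, y).
Proof.
rewrite /= /kernel_fun; have [xr|xr] := boolP (x \in r y).
  rewrite (bigD1_seq x)//= big1 ?addr0; first by rewrite eqxx mulr1 mul1r.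
  by move=> z /negbTE zx; rewrite zx mulr0.
rewrite mul0r big1_seq// => z /andP[_ zr].
have /negbTE zx : z != x by apply: contraNneq xr => <-.
by rewrite delta_eq zx mulr0.
Qed.

End kernel_operator.

(** Local finiteness of the inverse of [A] bounds the rows of the kernel, that of [A] its
    columns. *)
Lemma ex_roe_kernel (R : realType) (X : choiceType) (E : coarse_structure X)
    (A : set (X * X)) (t : X * X -> R[i]) :
  uniformly_locally_finite E -> entourage E A ->
  (forall p, Normc.normc (t p) <= 1)%R ->
  exists T : roe R E, forall x y,
    T (delta R x) y = ((if `[< A (x, y) >] then t (x, y) else 0)%R : R[i]).
Proof.
move=> hE EA t1.
have [_ [m Am]] := uniformly_locally_finite_seq hE EA.
have [fA [n An]] := uniformly_locally_finite_seq hE (coarse_inverse EA).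
pose r y : seq X := fset_set [set x | (A^-1)%relation (y, x)].
have rE x y : (x \in r y) = `[< A (x, y) >].
  by rewrite in_fset_set//; apply/idP/asboolP; rewrite inE.
have ru y : uniq (r y) by exact: fset_uniq.
have rn y : (size (r y) <= n)%N.
  by apply: (An y) => // x; rewrite rE => /asboolP.
have rm x s : uniq s -> {in s, forall y, x \in r y} -> (size s <= m)%N.
  by move=> us sr; apply: (Am x) => // y /sr; rewrite rE => /asboolP.
pose K := kernel_op ru rn rm t1.
have KE x y : K (delta R x) y = ((if `[< A (x, y) >] then t (x, y) else 0)%R : R[i]).
  rewrite kernel_op_delta rE; case: asboolP; rewrite ?mul1r ?mul0r//.
have KR : K \in @roe_pred R X E.
  apply/asboolP; apply: coarse_subset EA => -[x y].
  rewrite /supp/= inner_delta KE; case: asboolP => // _; rewrite eqxx//.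
by exists (Roe KR).
Qed.

(** * Diagonal matrix units and the corners they cut out *)

Section coordinate_projection.
Context {R : realType} {X : choiceType}.
Local Open Scope ring_scope.
Local Notation normc := Normc.normc.

Lemma inner_eq0 (f : ell2 R X) : inner f f = 0 -> f = 0.
Proof.
move=> f0; apply: val_inj; apply/funext => x; apply: Normc.eq0_normc.
apply/eqP; rewrite -sqrf_eq0 eq_le sqr_ge0 andbT.
have := seq_le_nnsum (nsq_summable f) (isT : uniq [:: x]).
by rewrite big_seq1 -/(nsq f) -inner_nsq f0.
Qed.

Lemma inner_sumr (T : Type) (s : seq T) (f : ell2 R X) (g : T -> ell2 R X) :
  inner f (\sum_(i <- s) g i) = \sum_(i <- s) inner f (g i).
Proof.
elim: s => [|i s IH]; first by rewrite !big_nil innerC inner0l conjc0.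
by rewrite !big_cons innerDr IH.
Qed.

Lemma inner_sum_left (T : Type) (s : seq T) (f : T -> ell2 R X) (g : ell2 R X) :
  inner (\sum_(i <- s) f i) g = \sum_(i <- s) inner (f i) g.
Proof.
elim: s => [|i s IH]; first by rewrite !big_nil inner0l.
by rewrite !big_cons innerDl IH.
Qed.

Lemma ell2_sumE (T : Type) (s : seq T) (f : T -> ell2 R X) x :
  (\sum_(i <- s) f i) x = \sum_(i <- s) (f i x : R[i]).
Proof.
elim: s => [|i s IH]; first by rewrite !big_nil.
by rewrite !big_cons -IH.
Qed.

Lemma coord_proj_bounded (x : X) :
  (fun f : ell2 R X => (f x : R[i]) *: delta R x) \in @bounded_linear R X.
Proof.
rewrite /in_mem/=; apply/bounded_linearP; split=> [a u v|].
  by rewrite scalerA -scalerDl.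
exists (nsq (delta R x)) => [|f]; first exact: nsq_ge0.
rewrite nsqZ mulrC ler_wpM2l ?nsq_ge0//.
by have := seq_le_nnsum (nsq_summable f) (isT : uniq [:: x]); rewrite big_seq1.
Qed.

Context (E : coarse_structure X).

Lemma coord_proj_roe x : BoundedOp (coord_proj_bounded x) \in @roe_pred R X E.
Proof.
apply/asboolP; apply: coarse_subset (coarse_diagonal E) => -[y z].
rewrite /supp/= innerZl inner_delta !delta_eq.
have [->|] := eqVneq x y; last by rewrite mul0r eqxx.
have [->//|] := eqVneq z y; by rewrite mulr0 eqxx.
Qed.

Definition coord_proj x : roe R E := Roe (coord_proj_roe x).

Lemma coord_projE x (f : ell2 R X) : coord_proj x f = (f x : R[i]) *: delta R x.
Proof. by []. Qed.

Lemma roeM (S T : roe R E) f : (S * T) f = S (T f). Proof. by []. Qed.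

Lemma roeZ (a : R[i]) (T : roe R E) f : (a *: T) f = a *: T f. Proof. by []. Qed.

Lemma roe_sumE (I : Type) (s : seq I) (T : I -> roe R E) f :
  (\sum_(i <- s) T i) f = \sum_(i <- s) T i f.
Proof.
elim: s => [|i s IH]; first by rewrite !big_nil.
by rewrite !big_cons -IH.
Qed.

Lemma roe_ext (S T : roe R E) : (forall f, S f = T f) -> S = T.
Proof. by move=> ST; do 2!apply: val_inj; apply/funext => f; exact: ST. Qed.

Lemma coord_proj_idem x : coord_proj x * coord_proj x = coord_proj x.
Proof.
apply: roe_ext => f; rewrite roeM !coord_projE.
by rewrite [X in X *: _](_ : _ = (f x : R[i]) * (x == x)%:R)// eqxx mulr1.
Qed.

Lemma coord_proj_adjoint x : roe_adjoint (coord_proj x) = coord_proj x.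
Proof.
apply: roe_ext => g; apply: val_inj; apply/funext => y.
have -> : val (roe_adjoint (coord_proj x) g) y = inner g (coord_proj x (delta R y)) by [].
rewrite coord_projE innerZr inner_delta delta_eq.
rewrite [RHS](_ : _ = (g x : R[i]) * (y == x)%:R)// mulrC eq_sym.
by case: (y == x); rewrite ?conjc1 ?conjc0.
Qed.

Lemma coord_proj_mulE x x' (T : roe R E) f :
  (coord_proj x' * T * coord_proj x) f =
    ((f x : R[i]) * T (delta R x) x') *: delta R x'.
Proof. by rewrite !roeM [in LHS](coord_projE x) linearZ coord_projE. Qed.

(** A corner between two coordinate projections sees a single matrix entry, so corners scale as
    these entries do. *)
Lemma coord_proj_corner x x' (S T : roe R E) (a : R[i]) :
  T (delta R x) x' = a * S (delta R x) x' ->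
  coord_proj x' * T * coord_proj x = a *: (coord_proj x' * S * coord_proj x).
Proof.
move=> Ta; apply: roe_ext => f; rewrite roeZ !coord_proj_mulE Ta scalerA.
by rewrite mulrCA.
Qed.

Lemma roe_innerP (T : roe R E) f g : inner (T f) g = inner f (roe_adjoint T g).
Proof. exact: adjointP. Qed.

End coordinate_projection.

(** * Images of coordinate projections under a star isomorphism *)

Section star_isomorphism.
Context {R : realType}.
Local Open Scope ring_scope.

Lemma star_isomorphism_inv (X Y : choiceType) (E : coarse_structure X)
    (F : coarse_structure Y) (Phi : roe R E -> roe R F) :
  star_isomorphism Phi ->
  exists Psi : roe R F -> roe R E,
    [/\ star_isomorphism Psi, cancel Phi Psi & cancel Psi Phi].
Proof.
move=> [lin mul adj [Psi PhiK PsiK]]; exists Psi; split=> //; split.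
- by move=> a u v; apply: (can_inj PhiK); rewrite lin !PsiK.
- by move=> u v; apply: (can_inj PhiK); rewrite mul !PsiK.
- by move=> u; apply: (can_inj PhiK); rewrite adj !PsiK.
- by exists Phi.
Qed.

Context {X Y : choiceType} {E : coarse_structure X} {F : coarse_structure Y}.
Context (Phi : roe R E -> roe R F).
Hypothesis hPhi : star_isomorphism Phi.

Lemma star_isomorphismM : {morph Phi : S T / S * T}. Proof. by case: hPhi. Qed.

Lemma star_isomorphismZ a S : Phi (a *: S) = a *: Phi S.
Proof.
have [lin _ _ _] := hPhi.
pose L : {linear roe R E -> roe R F} :=
  HB.pack Phi (GRing.isLinear.Build _ _ _ _ Phi lin).
exact: (linearZ_LR L).
Qed.

Lemma star_isomorphism_sum (I : Type) (s : seq I) (T : I -> roe R E) :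
  Phi (\sum_(i <- s) T i) = \sum_(i <- s) Phi (T i).
Proof.
have [lin _ _ _] := hPhi.
pose L : {linear roe R E -> roe R F} :=
  HB.pack Phi (GRing.isLinear.Build _ _ _ _ Phi lin).
exact: (linear_sum L).
Qed.

Let P x := Phi (coord_proj E x).

Let P_idem x f : P x (P x f) = P x f.
Proof. by rewrite -roeM -star_isomorphismM coord_proj_idem. Qed.

Let P_sym x f g : inner (P x f) g = inner f (P x g).
Proof.
have [_ _ adj _] := hPhi.
by rewrite roe_innerP -adj coord_proj_adjoint.
Qed.

(* [P x] is a minimal projection, so the supports of its columns all lie in a
   single finite section of its own support. *)
Lemma finite_image_coord_proj x : uniformly_locally_finite F ->
  finite_set [set y | P x (delta R y) != 0].
Proof.
(* Minimality: [coord_proj E x] compresses every operator to a multiple of itself, and the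
   surjective [Phi] carries this over to [P x]. *)
move=> hF; have corner (S : roe R F) : exists c : R[i], P x * S * P x = c *: P x.
  have [_ _ _ [Psi _ PsiK]] := hPhi.
  exists (Psi S (delta R x) x : R[i]).
  rewrite -[S in LHS]PsiK -!star_isomorphismM -star_isomorphismZ; congr Phi.
  rewrite (@coord_proj_corner _ _ _ _ _ 1 _ (Psi S (delta R x) x : R[i])).
    by rewrite mulr1 coord_proj_idem.
  by rewrite [X in _ * X](_ : _ = (x == x)%:R :> R[i])// eqxx mulr1.
have [[y0 Py0]|noy] := pselect (exists y0, P x (delta R y0) != 0); last first.
  rewrite [X in finite_set X](_ : _ = set0)//.
  by apply/seteqP; split=> // y Py; apply: noy; exists y.
have [fin _] := uniformly_locally_finite_seq hF (asboolW (roeP (P x))).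
apply: sub_finite_set (fin y0) => y /= Py.
(* If this entry were 0, the corner identity for [coord_proj F y] at [delta R y0] would force
   [c = 0]; at [delta R y] it would then make the squared norm of [P x (delta R y)] vanish. *)
rewrite /supp/= inner_delta; apply/eqP => Py0y.
have [c cE] := corner (coord_proj F y).
have cv z : (P x (delta R z) y : R[i]) *: P x (delta R y) = c *: P x (delta R z).
  have := congr1 (fun T : roe R F => T (delta R z)) cE.
  by rewrite roeZ !roeM coord_projE linearZ.
have c0 : c = 0.
  have := cv y0; rewrite Py0y scale0r => /esym/eqP.
  by rewrite scaler_eq0 (negbTE Py0) orbF => /eqP.
have := cv y; rewrite c0 scale0r => /eqP; rewrite scaler_eq0 (negbTE Py) orbF.
move=> /eqP Pyy; move/eqP: Py; apply; apply: inner_eq0.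
by rewrite P_sym P_idem -P_sym inner_delta.
Qed.

(** Being self-adjoint with finitely many nonzero columns, [q] is a finite sum of products
    [coord_proj E x * q]; apply [Phi] and evaluate at [delta R y]. *)
Lemma delta_sum_image_coord_proj (y : Y) (q : roe R E) :
  Phi q = coord_proj F y -> finite_set [set x | q (delta R x) != 0] ->
  exists2 s : seq X, uniq s & delta R y = \sum_(x <- s) P x (delta R y).
Proof.
move=> qE fq; exists (fset_set [set x | q (delta R x) != 0]); first exact: fset_uniq.
set s := fset_set _.
have q_sym : roe_adjoint q = q.
  have [_ _ adj bij] := hPhi; apply: (bij_inj bij).
  by rewrite adj qE coord_proj_adjoint.
have sq : \sum_(x <- s) coord_proj E x * q = q.
  apply: roe_ext => f; apply: val_inj; apply/funext => z.
  rewrite roe_sumE [LHS]ell2_sumE.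
  have qz x : (coord_proj E x * q) f z = (q f x : R[i]) * (z == x)%:R.
    by rewrite roeM coord_projE.
  under eq_bigr do rewrite qz.
  have [zs|zs] := boolP (z \in s).
    rewrite (bigD1_seq z) ?fset_uniq//= eqxx mulr1 big1 ?addr0// => x xz.
    by rewrite eq_sym (negbTE xz) mulr0.
  rewrite big1_seq => [|x /andP[_ xs]].
    (* Row [z] of [q] is the conjugate of its column [z], which is zero outside [s]. *)
    apply/esym; rewrite -[LHS]inner_delta roe_innerP q_sym.
    move: zs; rewrite in_fset_set// notin_setE/= => /negP; rewrite negbK => /eqP ->.
    by rewrite innerC inner0l conjc0.
  by have [zx|] := eqVneq z x; [rewrite zx xs in zs|rewrite mulr0].
have := congr1 (fun T : roe R F => T (delta R y)) (congr1 Phi sq).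
rewrite star_isomorphism_sum qE roe_sumE => /esym.
have ey : coord_proj F y (delta R y) = delta R y.
  by rewrite coord_projE delta_eq eqxx scale1r.
rewrite ey => {1}->; apply: eq_bigr => x _.
by rewrite star_isomorphismM qE roeM ey.
Qed.

(** Confines the entries to which a given corner contributes; [P x'] is moved across the inner
    product by symmetry. *)
Lemma image_corner_neq0 x x' y y' (T : roe R E) :
  inner (Phi (coord_proj E x' * T * coord_proj E x) (delta R y)) (delta R y') != 0 ->
  P x (delta R y) != 0 /\ P x' (delta R y') != 0.
Proof.
rewrite !star_isomorphismM 2!roeM P_sym => /eqP H; split; apply/eqP => P0; apply: H.
  by rewrite P0 linear0 inner0l.
by rewrite P0 innerC inner0l conjc0.
Qed.

(** Both basis vectors are expanded, and symmetry moves [P x'] to the left, where it completes the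
    corner. *)
Lemma image_entryE y y' (s s' : seq X) (T : roe R E) :
  delta R y = \sum_(x <- s) P x (delta R y) ->
  delta R y' = \sum_(x <- s') P x (delta R y') ->
  inner (Phi T (delta R y)) (delta R y') =
  \sum_(x <- s) \sum_(x' <- s')
    inner (Phi (coord_proj E x' * T * coord_proj E x) (delta R y)) (delta R y').
Proof.
move=> ys ys'; rewrite [in LHS]ys linear_sum inner_sum_left.
apply: eq_bigr => x _; rewrite [in LHS]ys' inner_sumr.
by apply: eq_bigr => x' _; rewrite -P_sym !star_isomorphismM !roeM.
Qed.

End star_isomorphism.

(** * A test operator on [A] whose image has the largest support *)

Theorem theorem8p4 (R : realType) (X Y : choiceType)
    (E : coarse_structure X) (F : coarse_structure Y)
    (hE : uniformly_locally_finite E) (hF : uniformly_locally_finite F)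
    (Phi : roe R E -> roe R F) (hPhi : star_isomorphism Phi) :
  forall A : set (X * X), entourage E A ->
  exists2 B : set (Y * Y), entourage F B &
    forall T : roe R E, supp T `<=` A -> supp (Phi T) `<=` B.
Proof.
move=> A EA.
have [Psi [hPsi PhiK PsiK]] := star_isomorphism_inv hPhi.
have finP x : finite_set [set y | Phi (coord_proj E x) (delta R y) != 0%R].
  exact: (finite_image_coord_proj hPhi).
have expand y : {s : seq X |
    uniq s & delta R y = (\sum_(x <- s) Phi (coord_proj E x) (delta R y))%R}.
  apply: cid2; apply: (delta_sum_image_coord_proj hPhi (PsiK (coord_proj F y))).
  exact: finite_image_coord_proj.
have [s us sE] := all_sig2 expand.
(* [u] is the 0-1 matrix of [A]; its corners are the units in which the corners of any [T] supported
   in [A] are measured. *)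
have [|u uE] := ex_roe_kernel (t := fun=> 1%R : R[i]) hE EA.
  by move=> _; rewrite Normc.normc1.
pose c (i : Y * Y) (p : X * X) : R[i] := inner
  (Phi (coord_proj E p.2 * u * coord_proj E p.1)%R (delta R i.1)) (delta R i.2).
pose S (i : Y * Y) := [seq (x, x') | x <- s i.1, x' <- s i.2].
have entryE (T : roe R E) i : supp T `<=` A ->
    inner (Phi T (delta R i.1)) (delta R i.2) =
    (\sum_(p <- S i) c i p * (T (delta R p.1) p.2 : R[i]))%R.
  move=> TA; rewrite (image_entryE hPhi T (sE i.1) (sE i.2)) big_allpairs_dep.
  apply: eq_bigr => x _; apply: eq_bigr => x' _.
  rewrite (@coord_proj_corner _ _ _ _ _ u _ (T (delta R x) x' : R[i])); last first.
    rewrite uE; case: asboolP => [_|nA]; first by rewrite mulr1.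
    rewrite mulr0; apply/eqP; apply: contra_notT nA => Txx'; apply: TA.
    by rewrite /supp/= inner_delta.
  by rewrite star_isomorphismZ// roeZ innerZl mulrC.
have [||t t1 tn] := @ex_nonvanishing _ _ _ S c.
- by move=> i; apply: allpairs_uniq => // -[? ?] [? ?].
(* For fixed [p], a nonzero [c i p] puts [i] in the product of two finite column supports. *)
- move=> p; apply: (sub_finite_set (B := _ `*` _)); last first.
    exact: finite_setX (finP p.1) (finP p.2).
  by move=> [y y'] [_ /(image_corner_neq0 hPhi)].
have [|T0 T0E] := ex_roe_kernel (t := t) hE EA.
  by move=> p; rewrite -lecR; have := t1 p; rewrite normc_def; case: (t p).
have T0A : supp T0 `<=` A.
  move=> [x x']; rewrite /supp/= inner_delta T0E.
  by case: asboolP => // _; rewrite eqxx.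
exists (supp (Phi T0)) => [|T TA [y y']]; first exact: asboolW (roeP (Phi T0)).
rewrite /supp/= (entryE T (y, y') TA) (entryE T0 (y, y') T0A) => cT.
(* Entries of [T0] agree with [t] only on [A]; off [A] the corner of [u], hence the coefficient [c],
   is 0. *)
have -> : (\sum_(p <- S (y, y')) c (y, y') p * (T0 (delta R p.1) p.2 : R[i]) =
  \sum_(p <- S (y, y')) c (y, y') p * t p)%R.
  apply: eq_bigr => -[x x'] _; rewrite T0E; case: asboolP => // nA.
  rewrite /c/= (@coord_proj_corner _ _ _ _ _ u _ 0%R).
    by rewrite star_isomorphismZ// scale0r inner0l !mul0r.
  by rewrite uE mul0r; case: asboolP.
(* A nonzero entry of [Phi T] needs a nonzero coefficient, and then [t] does not annihilate the
   functional. *)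
apply: tn; apply: contrapT => H; move/eqP: cT; apply.
rewrite big1_seq// => p /andP[_ pS].
have [->|cp] := eqVneq (c (y, y') p) 0%R; first by rewrite mul0r.
by exfalso; apply: H; exists p.
Qed.
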